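(* Let $\theta\in(0,1)$. The Dirichlet-Neumann algorithm DN$_1$ converges if and only if $$\rho_{\mathrm{DN}_1}:=\max_{1\le i\le n}\Big|1-\theta\Big(1-\nu^{-1}\frac{\sigma_i\gamma+\beta_i\tanh(b_i)}{\big(\sigma_i+d_i\tanh(a_i)\big)\big(\omega_i+\sigma_i\tanh(b_i)\big)}\Big)\Big|<1.$$
   Context: Let $A\in\mathbb{R}^{n\times n}$ be symmetric with eigenvalues $d_1,\dots,d_n$, and let $\nu>0$, $\gamma\ge 0$, $T>0$, $0<\alpha<T$. Set $\Omega_1=(0,\alpha)$, $\Omega_2=(\alpha,T)$, $\sigma_i=\sqrt{d_i^2+\nu^{-1}}$, $\omega_i=\nu^{-1}\gamma+d_i$, $\beta_i=1-\gamma d_i$, $a_i=\sigma_i\alpha$, $b_i=\sigma_i(T-\alpha)$. Algorithm DN$_1$ (error equations): for each $i$, given an initial guess $f_i^0\in\mathbb{R}$, for $k=1,2,\dots$: (1) solve $\dot z_{1,i}^k+d_iz_{1,i}^k-\nu^{-1}\mu_{1,i}^k=0$, $\dot\mu_{1,i}^k-z_{1,i}^k-d_i\mu_{1,i}^k=0$ in $\Omega_1$ with $z_{1,i}^k(0)=0$, $\mu_{1,i}^k(\alpha)=f_i^{k-1}$; (2) solve $\dot z_{2,i}^k+d_iz_{2,i}^k-\nu^{-1}\mu_{2,i}^k=0$, $\dot\mu_{2,i}^k-z_{2,i}^k-d_i\mu_{2,i}^k=0$ in $\Omega_2$ with $\dot z_{2,i}^k(\alpha)=\dot z_{1,i}^k(\alpha)$,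 $\mu_{2,i}^k(T)+\gamma z_{2,i}^k(T)=0$; (3) set $f_i^k=(1-\theta)f_i^{k-1}+\theta\mu_{2,i}^k(\alpha)$. Assume all subdomain problems are uniquely solvable for every datum, so that the algorithm is well defined. The algorithm converges if $f_i^k\to 0$ as $k\to\infty$ for every $i$ and every initial guess $(f_1^0,\dots,f_n^0)\in\mathbb{R}^n$. *)

(* Defs.v *)
From HB Require Import structures.
From mathcomp Require Import all_boot all_order all_algebra.
From mathcomp Require Import all_classical all_reals all_analysis.

Set Implicit Arguments.
Unset Strict Implicit.
Unset Printing Implicit Defensive.

Import Order.TTheory GRing.Theory Num.Theory.
Import numFieldNormedType.Exports.

Local Open Scope classical_set_scope.
Local Open Scope ring_scope.

Definition tanh (R : realType) (x : R) : R :=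
  (expR x - expR (- x)) / (expR x + expR (- x)).

Definition sigma (R : realType) (nu d : R) : R := Num.sqrt (d ^+ 2 + nu^-1).

Definition omega (R : realType) (nu gamma d : R) : R := nu^-1 * gamma + d.

Definition beta (R : realType) (gamma d : R) : R := 1 - gamma * d.

(* One-sided derivatives: the values of dz/dt at the interface, which is an
   endpoint of both time intervals. *)
Definition is_left_derivative (R : realType) (f : R -> R) (x l : R) : Prop :=
  (f t - f x) / (t - x) @[t --> x^'-] --> l.

Definition is_right_derivative (R : realType) (f : R -> R) (x l : R) : Prop :=
  (f t - f x) / (t - x) @[t --> x^'+] --> l.

(* The system holds in the open interval ]a, b[; z and mu are continuous up to
   the endpoints, so that boundary conditions make sense. Values of z and mu
   outside [a, b] are irrelevant. *)
Definition solves_system (R : realType) (nu d a b : R) (z mu : R -> R) : Prop :=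
  [/\ derivable_oo_LRcontinuous z a b,
      derivable_oo_LRcontinuous mu a b &
      forall t, a < t < b ->
        derive1 z t + d * z t - nu^-1 * mu t = 0 /\
        derive1 mu t - z t - d * mu t = 0].

Definition solves_dirichlet (R : realType) (nu d alpha f : R)
    (z mu : R -> R) : Prop :=
  [/\ solves_system nu d 0 alpha z mu, z 0 = 0 & mu alpha = f].

Definition solves_neumann (R : realType) (nu gamma d alpha T g : R)
    (z mu : R -> R) : Prop :=
  [/\ solves_system nu d alpha T z mu,
      is_right_derivative z alpha g &
      mu T + gamma * z T = 0].

Definition uniquely_solvable (R : realType) (a b : R)
    (solves : (R -> R) -> (R -> R) -> Prop) : Prop :=
  (exists z mu, solves z mu) /\
  (forall z mu z' mu', solves z mu -> solves z' mu' ->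
     forall t, a <= t <= b -> z t = z' t /\ mu t = mu' t).

Definition DN1_well_posed (R : realType) (nu gamma alpha T d : R) : Prop :=
  (forall f : R, uniquely_solvable 0 alpha (solves_dirichlet nu d alpha f)) /\
  (forall g : R,
     uniquely_solvable alpha T (solves_neumann nu gamma d alpha T g)).

Definition DN1_step (R : realType) (nu gamma alpha T theta d fold fnew : R)
    : Prop :=
  exists z1 mu1 z2 mu2 : R -> R, exists g : R,
    [/\ solves_dirichlet nu d alpha fold z1 mu1,
        is_left_derivative z1 alpha g,
        solves_neumann nu gamma d alpha T g z2 mu2 &
        fnew = (1 - theta) * fold + theta * mu2 alpha].

(* Under [DN1_well_posed] every initial guess f0 has exactly one sequence of
   iterates, so quantifying over all such sequences f is not vacuous. *)
Definition DN1_converges (R : realType) (nu gamma alpha T theta : R) (n : nat)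
    (d : 'I_n -> R) : Prop :=
  forall (f0 : 'I_n -> R) (f : 'I_n -> nat -> R),
    (forall i, f i 0%N = f0 i) ->
    (forall i k, DN1_step nu gamma alpha T theta (d i) (f i k) (f i k.+1)) ->
    forall i, f i k @[k --> \oo] --> (0 : R).

(* A maximum over 'I_n; the default value 0 is harmless because the terms are
   nonnegative. *)
Definition rho_DN1 (R : realType) (nu gamma alpha T theta : R) (n : nat)
    (d : 'I_n -> R) : R :=
  \big[Num.max/0]_(i < n)
    let s := sigma nu (d i) in
    let a := s * alpha in
    let b := s * (T - alpha) in
    `| 1 - theta *
         (1 - nu^-1 * ((s * gamma + beta gamma (d i) * tanh b) /
               ((s + d i * tanh a) * (omega nu gamma (d i) + s * tanh b)))) |.

(* Main.v *)
(* On each mode the subdomain problems have explicit hyperbolic solutions, which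
   by well-posedness are the only ones. Composing the Dirichlet-to-flux map of
   the first subdomain with the flux-to-trace map of the second shows that one
   iteration multiplies f_i by a constant r_i, so f_i^k = r_i^k f_i^0; the
   algorithm converges if and only if |r_i| < 1 for all i, and rho_DN1 is the
   maximum of the |r_i|. *)
Require Import Defs.
From HB Require Import structures.
From mathcomp Require Import all_boot all_order all_algebra.
From mathcomp Require Import all_classical all_reals all_analysis.
From mathcomp Require Import ring lra.

Set Implicit Arguments.
Unset Strict Implicit.
Unset Printing Implicit Defensive.

Import Order.TTheory GRing.Theory Num.Theory.
Import numFieldNormedType.Exports.

Local Open Scope classical_set_scope.
Local Open Scope ring_scope.

(** * Hyperbolic functions and their derivatives *)

Definition cosh (R : realType) (x : R) : R := (expR x + expR (- x)) / 2.

Definition sinh (R : realType) (x : R) : R := (expR x - expR (- x)) / 2.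

Lemma cosh_gt0 (R : realType) (x : R) : 0 < cosh x.
Proof. by rewrite divr_gt0// addr_gt0 ?expR_gt0. Qed.

Lemma sinhN (R : realType) (x : R) : sinh (- x) = - sinh x.
Proof. by rewrite /sinh opprK; field. Qed.

Lemma coshN (R : realType) (x : R) : cosh (- x) = cosh x.
Proof. by rewrite /cosh opprK addrC. Qed.

Lemma sinh0 (R : realType) : sinh (0 : R) = 0.
Proof. by rewrite /sinh oppr0 subrr mul0r. Qed.

Lemma cosh0 (R : realType) : cosh (0 : R) = 1.
Proof. by rewrite /cosh oppr0 expR0 divff. Qed.

Lemma sinhE (R : realType) (x : R) : sinh x = tanh x * cosh x.
Proof.
rewrite /sinh /tanh /cosh; field.
by rewrite gt_eqF// addr_gt0 ?expR_gt0.
Qed.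

Lemma norm_tanh_lt1 (R : realType) (x : R) : `|tanh x| < 1.
Proof.
have p := expR_gt0 x; have q := expR_gt0 (- x).
rewrite /tanh normrM normfV [X in _ / X]gtr0_norm ?addr_gt0//.
rewrite ltr_pdivrMr ?addr_gt0// mul1r ltr_norml; apply/andP; split; lra.
Qed.

Lemma is_derive_expR_affine (R : realType) (s p t : R) :
  is_derive t 1 (fun t => expR (s * (t - p))) (s * expR (s * (t - p))).
Proof.
have h : is_derive t 1 (fun t => s * (t - p)) s.
  by apply: is_derive_eq; rewrite /GRing.scale/=; ring.
rewrite mulrC; exact: (@is_derive1_comp _ expR (fun t => s * (t - p))).
Qed.

Lemma is_derive_cosh_affine (R : realType) (s p t : R) :
  is_derive t 1 (fun t => cosh (s * (t - p))) (s * sinh (s * (t - p))).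
Proof.
have -> : (fun t => cosh (s * (t - p))) =
    (fun t => (expR (s * (t - p)) + expR (- s * (t - p))) / 2).
  by apply/funext => y; rewrite /cosh mulNr.
have h1 := is_derive_expR_affine s p t.
have h2 := is_derive_expR_affine (- s) p t.
by apply: is_derive_eq; rewrite /GRing.scale/= /sinh mulNr; ring.
Qed.

Lemma is_derive_sinh_affine (R : realType) (s p t : R) :
  is_derive t 1 (fun t => sinh (s * (t - p))) (s * cosh (s * (t - p))).
Proof.
have -> : (fun t => sinh (s * (t - p))) =
    (fun t => (expR (s * (t - p)) - expR (- s * (t - p))) / 2).
  by apply/funext => y; rewrite /sinh mulNr.
have h1 := is_derive_expR_affine s p t.
have h2 := is_derive_expR_affine (- s) p t.
by apply: is_derive_eq; rewrite /GRing.scale/= /cosh mulNr; ring.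
Qed.

(** * One-sided derivatives *)

(** The substitution [t = x + h] turns the difference quotient in [h] behind [is_derive] into the
    slope in [t] used by the one-sided derivatives. *)
Lemma is_derive_slope (R : realType) (f : R -> R) (x l : R) :
  is_derive x 1 f l -> (f t - f x) / (t - x) @[t --> x^'] --> l.
Proof.
move=> [df dl]; have : h^-1 *: (f (h *: 1 + x) - f x) @[h --> 0^'] --> l.
  by rewrite -dl; exact: df.
move=> /cvgrPdist_lt H; apply/cvgrPdist_lt => e /H{H}.
rewrite !near_withinE => H.
suff : \forall t \near x, t != x -> `|l - (f t - f x) / (t - x)| < e by [].
apply/nbhs0P; near=> h => /= hx.
have hE : x + h - x = h by rewrite addrC addKr.
have := near H h; rewrite hE [h%:A]mulr1 (addrC h) mulrC; apply => //.
by apply: contra_neq hx => ->; rewrite addr0.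
Unshelve. all: by end_near. Qed.

Lemma is_derive_is_left_derivative (R : realType) (f : R -> R) (x l : R) :
  is_derive x 1 f l -> is_left_derivative f x l.
Proof. by move=> /is_derive_slope; exact: cvg_dnbhs_at_left. Qed.

Lemma is_derive_is_right_derivative (R : realType) (f : R -> R) (x l : R) :
  is_derive x 1 f l -> is_right_derivative f x l.
Proof. by move=> /is_derive_slope; exact: cvg_dnbhs_at_right. Qed.

Lemma is_left_derivative_unique (R : realType) (f : R -> R) (x l l' : R) :
  is_left_derivative f x l -> is_left_derivative f x l' -> l = l'.
Proof. exact: cvg_unique. Qed.

(** Uniqueness of solutions only gives equality on a closed interval; a left derivative at its right
    endpoint sees nothing else. *)
Lemma eq_is_left_derivative (R : realType) (f g : R -> R) (a b l : R) :
  a < b -> (forall t, a <= t <= b -> f t = g t) ->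
  is_left_derivative f b l -> is_left_derivative g b l.
Proof.
move=> ab fg; apply: cvg_trans; apply: near_eq_cvg; near=> t.
by rewrite !fg ?lexx ?(ltW ab)//; apply/andP; split; near: t;
  [exact: nbhs_left_ge|exact: nbhs_left_le].
Unshelve. all: by end_near. Qed.

Lemma derivable_derivable_oo_LRcontinuous (R : realType) (f : R -> R) (a b : R) :
  (forall t, derivable f t 1) -> derivable_oo_LRcontinuous f a b.
Proof.
move=> df; have cf t : {for t, continuous f}.
  exact/differentiable_continuous/derivable1_diffP.
split; [by move=> t _ |exact/cvg_at_right_filter/cf|
  exact/cvg_at_left_filter/cf].
Qed.

(** * Explicit solutions of the system *)

(* The solution of the system on the whole line with [z p = u] and
   [mu p = v]: the coefficient matrix [[-d, nu^-1], [1, d]] squares to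
   [sigma ^+ 2], so its exponential is a combination of cosh and sinh. *)
Definition zsol (R : realType) (nu d p u v t : R) : R :=
  let s := sigma nu d in
  u * cosh (s * (t - p)) + (nu^-1 * v - d * u) / s * sinh (s * (t - p)).

Definition musol (R : realType) (nu d p u v t : R) : R :=
  let s := sigma nu d in
  v * cosh (s * (t - p)) + (u + d * v) / s * sinh (s * (t - p)).

Section ExplicitSolutions.
Variables (R : realType) (nu d : R).
Hypothesis nu_gt0 : 0 < nu.

Let s := sigma nu d.

Lemma sigma_sqr : s ^+ 2 = d ^+ 2 + nu^-1.
Proof. by rewrite sqr_sqrtr// addr_ge0 ?sqr_ge0// invr_ge0 ltW. Qed.

Lemma sigma_gt_norm : `|d| < s.
Proof.
rewrite -sqrtr_sqr ltr_sqrt ?ltrDl ?invr_gt0//.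
by rewrite ltr_wpDl ?sqr_ge0 ?invr_gt0.
Qed.

Lemma sigma_gt0 : 0 < s.
Proof. exact: le_lt_trans sigma_gt_norm. Qed.

(** Follows from [|d| < s] and [|tanh x| < 1]. It makes the first denominator of the ratio nonzero
    without using well-posedness. *)
Lemma sigma_dtanh_gt0 (x : R) : 0 < s + d * tanh x.
Proof.
have : `|d * tanh x| < s.
  apply: le_lt_trans sigma_gt_norm.
  by rewrite normrM ler_piMr// ltW// norm_tanh_lt1.
by rewrite ltr_norml -subr_gt0 opprK addrC => /andP[].
Qed.

Lemma is_derive_zsol (p u v t : R) : is_derive t 1 (zsol nu d p u v)
  (- d * zsol nu d p u v t + nu^-1 * musol nu d p u v t).
Proof.
have h1 := is_derive_cosh_affine s p t.
have h2 := is_derive_sinh_affine s p t.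
apply: is_derive_eq; rewrite /GRing.scale/= /zsol /musol -/s.
have s0 : s != 0 by rewrite gt_eqF// sigma_gt0.
(* Eliminating [nu^-1] builds the relation between [s], [d] and [nu] into the goal, which becomes an
   identity of rational functions. *)
have nuE : nu^-1 = s ^+ 2 - d ^+ 2 by rewrite sigma_sqr addrC addKr.
by rewrite nuE; field.
Qed.

Lemma is_derive_musol (p u v t : R) : is_derive t 1 (musol nu d p u v)
  (zsol nu d p u v t + d * musol nu d p u v t).
Proof.
have h1 := is_derive_cosh_affine s p t.
have h2 := is_derive_sinh_affine s p t.
apply: is_derive_eq; rewrite /GRing.scale/= /zsol /musol -/s.
have s0 : s != 0 by rewrite gt_eqF// sigma_gt0.
have nuE : nu^-1 = s ^+ 2 - d ^+ 2 by rewrite sigma_sqr addrC addKr.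
by rewrite nuE; field.
Qed.

Lemma solves_system_explicit p u v a b :
  solves_system nu d a b (zsol nu d p u v) (musol nu d p u v).
Proof.
split=> [||t _].
- by apply: derivable_derivable_oo_LRcontinuous => t; have [] := is_derive_zsol p u v t.
- by apply: derivable_derivable_oo_LRcontinuous => t; have [] := is_derive_musol p u v t.
have h1 := is_derive_zsol p u v t.
have h2 := is_derive_musol p u v t.
by rewrite !derive1E !derive_val; split; ring.
Qed.

Lemma zsol_id p u v : zsol nu d p u v p = u.
Proof. by rewrite /zsol subrr mulr0 cosh0 sinh0; ring. Qed.

Lemma musol_id p u v : musol nu d p u v p = v.
Proof. by rewrite /musol subrr mulr0 cosh0 sinh0; ring. Qed.

(** * One iteration on a single mode *)

Section OneMode.
Variables gamma alpha T : R.
Hypotheses (alpha_gt0 : 0 < alpha) (alpha_ltT : alpha < T).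
Hypothesis well_posed : DN1_well_posed nu gamma alpha T d.

Let a := s * alpha.
Let b := s * (T - alpha).

(* The value of [mu2 alpha / mu1 alpha] in one iteration. *)
Definition DN1_ratio : R :=
  nu^-1 * ((s * gamma + beta gamma d * tanh b) /
           ((s + d * tanh a) * (omega nu gamma d + s * tanh b))).

(** The Dirichlet-to-flux map of the first subdomain: the slope of [z1] at [alpha] when
    [mu1 alpha = f]. *)
Definition dirichlet_flux (f : R) : R := nu^-1 * s * f / (s + d * tanh a).

Lemma dirichlet_explicit f :
  exists2 v, solves_dirichlet nu d alpha f (zsol nu d 0 0 v) (musol nu d 0 0 v) &
    is_left_derivative (zsol nu d 0 0 v) alpha (dirichlet_flux f).
Proof.
have s0 := lt0r_neq0 sigma_gt0.
have D0 := lt0r_neq0 (sigma_dtanh_gt0 a).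
have c0 := lt0r_neq0 (cosh_gt0 a).
(* Shooting from 0: with [z 0 = 0] and [mu 0 = v], one gets [mu alpha = v * cosh a * (s + d * tanh
   a) / s], which is solved for [v]. *)
exists (s * f / (cosh a * (s + d * tanh a))).
  split; [exact: solves_system_explicit|exact: zsol_id|].
  rewrite /musol -/s subr0 -/a sinhE; field; exact/and3P.
have := is_derive_zsol 0 0 (s * f / (cosh a * (s + d * tanh a))) alpha.
move=> /is_derive_is_left_derivative; congr is_left_derivative.
rewrite /zsol /musol -/s subr0 -/a sinhE /dirichlet_flux; field.
by rewrite s0 D0 c0 gt_eqF.
Qed.

Lemma dirichlet_left_derivative f z mu g :
  solves_dirichlet nu d alpha f z mu -> is_left_derivative z alpha g ->
  g = dirichlet_flux f.
Proof.
have [v sv gv] := dirichlet_explicit f.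
move=> sz gz; apply: is_left_derivative_unique gv.
apply: eq_is_left_derivative alpha_gt0 _ gz => t t01.
by have [] := (well_posed.1 f).2 _ _ _ _ sz sv t t01.
Qed.

(** Shooting backwards from [T] with [z T = c] and [mu T = - gamma * c] builds in the terminal
    condition. The datum is expressed through [c], not conversely, since its last factor is not yet
    known to be nonzero. *)
Lemma neumann_explicit c : solves_neumann nu gamma d alpha T
    (- c * cosh b * (omega nu gamma d + s * tanh b))
    (zsol nu d T c (- gamma * c)) (musol nu d T c (- gamma * c)).
Proof.
have s0 := lt0r_neq0 sigma_gt0.
split; [exact: solves_system_explicit| |by rewrite zsol_id musol_id; ring].
have := is_derive_zsol T c (- gamma * c) alpha.
move=> /is_derive_is_right_derivative; congr is_right_derivative.
(* The sinh coefficient is [- c * omega / s], and the argument at [alpha] is [- b]; the two signs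
   cancel. *)
have -> : zsol nu d T c (- gamma * c) alpha =
    c * (cosh b + omega nu gamma d / s * sinh b).
  rewrite /zsol -/s -(opprB T) mulrN -/b coshN sinhN /omega.
  by field; rewrite s0 gt_eqF.
rewrite /musol -/s -(opprB T) mulrN -/b coshN sinhN sinhE.
have nuE : nu^-1 = s ^+ 2 - d ^+ 2 by rewrite sigma_sqr addrC addKr.
by rewrite /omega nuE; field.
Qed.

(* Otherwise the homogeneous Neumann problem would have a nonzero solution. *)
Lemma neumann_denominator_neq0 : omega nu gamma d + s * tanh b != 0.
Proof.
apply/eqP => D0; have := neumann_explicit 1; have := neumann_explicit 0.
rewrite D0 !mulr0 => h0 h1.
have := (well_posed.2 0).2 _ _ _ _ h0 h1 T.
rewrite lexx (ltW alpha_ltT) !zsol_id => /(_ isT)[/esym/eqP].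
by rewrite oner_eq0.
Qed.

Lemma neumann_trace f z mu :
  solves_neumann nu gamma d alpha T (dirichlet_flux f) z mu ->
  mu alpha = DN1_ratio * f.
Proof.
have s0 := lt0r_neq0 sigma_gt0.
have D0 := neumann_denominator_neq0.
have E0 := lt0r_neq0 (sigma_dtanh_gt0 a).
have c0 := lt0r_neq0 (cosh_gt0 b).
(* The value of [z T] for which the explicit Neumann datum equals the flux from the first
   subdomain. *)
set c := - dirichlet_flux f / (cosh b * (omega nu gamma d + s * tanh b)).
have -> : dirichlet_flux f = - c * cosh b * (omega nu gamma d + s * tanh b).
  by rewrite /c; field; rewrite c0 D0.
move=> h; have [|_ ->] := (well_posed.2 _).2 _ _ _ _ h (neumann_explicit c) alpha.
  by rewrite lexx ltW.
rewrite /musol -/s -(opprB T) mulrN -/b coshN sinhN sinhE.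
rewrite /c /dirichlet_flux /DN1_ratio /beta; field.
by rewrite s0 D0 E0 c0 gt_eqF.
Qed.

(** Uniqueness gives the forward direction. The converse uses existence and is what allows geometric
    sequences to be realised as iterates. *)
Lemma DN1_stepP theta fold fnew :
  DN1_step nu gamma alpha T theta d fold fnew <->
  fnew = (1 - theta * (1 - DN1_ratio)) * fold.
Proof.
split=> [[z1 [mu1 [z2 [mu2 [g [s1 g1 s2 ->]]]]]]|->].
  move: s2; rewrite (dirichlet_left_derivative s1 g1) => /neumann_trace ->.
  by ring.
have [v s1 g1] := dirichlet_explicit fold.
have [z2 [mu2 s2]] := (well_posed.2 (dirichlet_flux fold)).1.
exists (zsol nu d 0 0 v), (musol nu d 0 0 v), z2, mu2, (dirichlet_flux fold).
by split=> //; rewrite (neumann_trace s2); ring.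
Qed.

End OneMode.
End ExplicitSolutions.

(** * Geometric sequences and convergence *)

(** If [|r| >= 1], every power has absolute value at least 1, so none comes within distance 1 of
    0. *)
Lemma cvg_expr0_lt1 (R : realType) (r : R) :
  r ^+ k @[k --> \oo] --> 0 -> `|r| < 1.
Proof.
move=> /cvgrPdist_lt/(_ 1 ltr01)[N _ /(_ N (leqnn N))].
rewrite /= sub0r normrN normrX ltNge => H; rewrite ltNge; apply: contra H.
exact: exprn_ege1.
Qed.

Theorem theorem1 (R : realType) (n : nat) (A : 'M[R]_n) (d : 'I_n -> R)
    (nu gamma T alpha theta : R)
    (n_gt0 : (0 < n)%N)
    (A_sym : A^T = A)
    (A_eigenvalues : char_poly A = \prod_(i < n) ('X - (d i)%:P))
    (nu_gt0 : 0 < nu) (gamma_ge0 : 0 <= gamma)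
    (T_gt0 : 0 < T) (alpha_itv : 0 < alpha < T)
    (well_posed : forall i, DN1_well_posed nu gamma alpha T (d i))
    (theta_itv : 0 < theta < 1) :
  DN1_converges nu gamma alpha T theta d <->
  rho_DN1 nu gamma alpha T theta d < 1.
Proof.
have /andP[alpha_gt0 alpha_ltT] := alpha_itv.
pose r i := 1 - theta * (1 - DN1_ratio nu (d i) gamma alpha T).
have stepP i x y : DN1_step nu gamma alpha T theta (d i) x y <-> y = r i * x.
  exact: DN1_stepP.
split=> [conv|/bigmax_ltP[_ rlt1] f0 f _ step i].
  apply/bigmax_ltP; split=> // i _; apply: (@cvg_expr0_lt1 _ (r i)).
  (* The initial guess 1 on every mode makes the iterates exactly the powers of [r i]. *)
  apply: (conv (fun=> 1) (fun i k => r i ^+ k)) => [j|j k].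
    by rewrite expr0.
  by apply/stepP; rewrite exprS.
have fE k : f i k = f i 0 * r i ^+ k.
  elim: k => [|k IH]; first by rewrite expr0 mulr1.
  by have /stepP -> := step i k; rewrite IH exprS; ring.
rewrite (_ : f i = geometric (f i 0) (r i)); last exact/funext.
exact/cvg_geometric/rlt1.
Qed.
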